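(* Fix an integer $h\ge 1$. Then, for any $a\neq c\in\{0,1,\dots,h\}$, the stars $S_{a,h-a}$ and $S_{c,h-c}$ are incomparable, i.e. there exist loopless digraphs $H,H'$ such that $$\hom(S_{a,h-a},H)>\hom(S_{c,h-c},H)\qquad\text{and}\qquad \hom(S_{a,h-a},H')<\hom(S_{c,h-c},H').$$ Equivalently, within the family $\{S_{a,h-a}\}_{a=0}^h$ the order $\preceq$ has no nontrivial comparabilities.
   Context: A digraph is a finite directed simple loopless graph: at most one arc for each ordered pair of distinct vertices (opposite arcs are allowed). $\hom(D,H)$ is the number of digraph homomorphisms $D\to H$ (maps $V(D)\to V(H)$ sending arcs to arcs, preserving direction). For integers $a,b\ge0$, $S_{a,b}$ is the directed star consisting of a centre and $a+b$ leaves, with $a$ arcs directed from a leaf into the centre and $b$ arcs directed from the centre to a leaf. The homomorphism order $\preceq$ is defined by: $T\preceq \widetilde T$ if $\hom(T,H)\le\hom(\widetilde T,H)$ for all finite digraphs $H$.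
   Formalization: The incomparability claim is stated for h ≥ 2 only, since for h = 1 the stars S_{0,1} and S_{1,0} are both a single arc and have equal hom counts; ''no nontrivial comparabilities'' is kept for all h ≥ 1, meaning that comparable stars are isomorphic. *)

(* Defs.v *)
From mathcomp Require Import all_boot.

Set Implicit Arguments.
Unset Strict Implicit.
Unset Printing Implicit Defensive.

Record digraph := Digraph {
  vertex :> finType;
  arc : rel vertex;
  arc_irr : irreflexive arc }.

Definition is_hom (D H : digraph) (f : {ffun D -> H}) : bool :=
  [forall x, forall y, arc x y ==> arc (f x) (f y)].

Definition hom (D H : digraph) : nat := #|[set f : {ffun D -> H} | is_hom f]|.

Definition hom_le (T T' : digraph) : Prop :=
  forall H : digraph, hom T H <= hom T' H.

Definition digraph_iso (D D' : digraph) : Prop :=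
  exists f : D -> D', bijective f /\ forall x y, arc (f x) (f y) = arc x y.

(* [None] is the centre, [Some (inl i)] are the in-leaves and [Some (inr j)]
   the out-leaves. *)
Definition star_arc (a b : nat) : rel (option ('I_a + 'I_b)) :=
  fun x y => match x, y with
             | Some (inl _), None => true
             | None, Some (inr _) => true
             | _, _ => false
             end.

Lemma star_arc_irr (a b : nat) : irreflexive (@star_arc a b).
Proof. by case=> [[i|j]|]. Qed.

Definition star (a b : nat) : digraph := Digraph (@star_arc_irr a b).

(* With a single leaf the two orientations give the same digraph, an arc, so
   [star 0 1] and [star 1 0] cannot be separated by homomorphism counts. *)
Lemma star01_iso : digraph_iso (star 0 1) (star 1 0).
Proof.
exists (fun x => if x is Some _ then None else Some (inl ord0)); split.
  exists (fun y => if y is Some _ then None else Some (inr ord0)).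
    by case=> [[[]//|j]|] //; rewrite (ord1 j).
  by case=> [[i|[]//]|] //; rewrite (ord1 i).
by case=> [[[]//|j]|] [[[]//|k]|].
Qed.

Lemma hom_iso_le (D D' : digraph) : digraph_iso D D' -> hom_le D D'.
Proof.
case=> f [[g fK gK] fE] H; rewrite /hom.
pose F (u : {ffun D -> H}) : {ffun D' -> H} := [ffun y => u (g y)].
have Finj : injective F.
  move=> u v /ffunP uv; apply/ffunP => x.
  by have := uv (f x); rewrite !ffunE fK.
rewrite -(card_imset _ Finj); apply/subset_leq_card/subsetP => v /imsetP[u].
rewrite !inE => /forallP uP ->; apply/forallP => x; apply/forallP => y.
have /forallP/(_ (g y)) := uP (g x).
by rewrite -fE !gK !ffunE.
Qed.

Lemma digraph_iso_sym (D D' : digraph) : digraph_iso D D' -> digraph_iso D' D.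
Proof.
case=> f [[g fK gK] fE]; exists g; split; first by exists f.
by move=> x y; rewrite -fE !gK.
Qed.

Lemma hom_star01 (H : digraph) : hom (star 0 1) H = hom (star 1 0) H.
Proof.
apply/eqP; rewrite eqn_leq (hom_iso_le star01_iso).
exact: (hom_iso_le (digraph_iso_sym star01_iso)).
Qed.

(* Main.v *)
Require Import Defs.
From mathcomp Require Import all_boot.

(** A homomorphism from a star is a choice of the image [v] of the centre and
    then, independently, of an in-neighbour of [v] for every in-leaf and of an
    out-neighbour of [v] for every out-leaf; so the number of homomorphisms
    from [star a b] to [H] is the sum over [v] of indeg(v)^a * outdeg(v)^b
    ([hom_star]).

    Stars themselves are good enough as targets.  In [star p q] the centre
    contributes p^a * q^b, while a leaf contributes 1 or 0: an in-leaf has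
    indegree 0 and outdegree 1, so it counts only when [a = 0], and an out-leaf
    only when [b = 0] ([hom_star_star]).  When [q < p] the centre favours the
    source star with more in-leaves; the only term that could spoil this is the
    contribution [p] of the in-leaves to a source star without in-leaves.
    Taking [q = 2] makes the centre beat that as well: for h >= 2 and a >= 1,
    p^a * 2^(h-a) >= 2p, which exceeds 2^h + p as soon as p > 2^h
    ([unbalanced_star_ltn]).  Exchanging the roles of in- and out-leaves in the
    target reverses the comparison, so any two different stars with the same
    number h >= 2 of leaves are separated in both directions.  For h = 1 both
    stars are a single arc. *)

Definition indeg (H : digraph) (v : H) : nat := #|[pred x : H | Defs.arc x v]|.
Definition outdeg (H : digraph) (v : H) : nat := #|[pred x : H | Defs.arc v x]|.

Lemma big_star_vertex (R : Type) (idx : R) (op : Monoid.com_law idx)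
    (a b : nat) (F : option ('I_a + 'I_b) -> R) :
  \big[op/idx]_x F x =
  op (F None) (op (\big[op/idx]_(i < a) F (Some (inl i)))
                  (\big[op/idx]_(j < b) F (Some (inr j)))).
Proof.
rewrite (bigD1 None) //= (@reindex_omap _ _ _ _ _ Some id) //; last by case.
by rewrite (eq_bigl predT) ?big_sumType // => x; rewrite eqxx.
Qed.

Lemma card_star_vertex (a b : nat) (P : pred (option ('I_a + 'I_b))) :
  #|P| = P None + (\sum_(i < a) P (Some (inl i)) + \sum_(j < b) P (Some (inr j))).
Proof.
rewrite -sum1_card big_mkcond big_star_vertex.
have ifE x : (if x \in P then 1 else 0) = P x :> nat by rewrite unfold_in; case: (P x).
by congr (_ + (_ + _)); rewrite ?ifE //; apply: eq_bigr => i _; rewrite ifE.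
Qed.

(** No two leaves are adjacent, so once the centre is sent to [v] the images of
    the other vertices are chosen independently; this makes the homomorphisms
    with a given image of the centre the [family] of these sets. *)
Definition star_target (a b : nat) (H : digraph) (v : H)
    (x : option ('I_a + 'I_b)) : pred H :=
  match x with
  | None => pred1 v
  | Some (inl _) => [pred y : H | Defs.arc y v]
  | Some (inr _) => [pred y : H | Defs.arc v y]
  end.

Lemma is_hom_starE (a b : nat) (H : digraph) (v : H)
    (f : {ffun star a b -> H}) :
  is_hom f && (f None == v) = (f \in family (star_target a b H v)).
Proof.
apply/andP/familyP => [[/forallP f_hom /eqP <-] x | f_fam].
  case: x => [[i|j]|] /=; rewrite inE //=.
  - by have /forallP/(_ None) := f_hom (Some (inl i)).
  - by have /forallP/(_ (Some (inr j))) := f_hom None.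
have /eqP fN := f_fam None; split; last by rewrite fN.
apply/forallP => x; apply/forallP => y; apply/implyP.
case: x y => [[i|j]|] [[k|l]|] //= _; rewrite fN.
- exact: (f_fam (Some (inl i))).
- exact: (f_fam (Some (inr l))).
Qed.

(** Sort the homomorphisms by the image of the centre; each class is a product
    of neighbourhoods. *)
Lemma hom_star (a b : nat) (H : digraph) :
  hom (star a b) H = \sum_(v : H) indeg H v ^ a * outdeg H v ^ b.
Proof.
rewrite /hom -sum1_card.
rewrite (partition_big (fun f : {ffun star a b -> H} => f None) predT) //=.
apply: eq_bigr => v _.
rewrite (eq_bigl (mem (family (star_target a b H v)))); last first.
  by move=> f; rewrite inE is_hom_starE.
rewrite sum1_card card_family foldrE big_map big_enum /= big_star_vertex.
by rewrite /= card1 mul1n !prod_nat_const !card_ord.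
Qed.

(** [hom_star] on a star: the terms with [a == 0] and [b == 0] are the
    contributions of the leaves of the target, of which one of the two degrees
    is 0 and the other 1, with 0 ^ 0 = 1. *)
Lemma hom_star_star (a b p q : nat) :
  hom (star a b) (star p q) = p ^ a * q ^ b + ((a == 0) * p + (b == 0) * q).
Proof.
have sum_const m (F : 'I_m -> nat) k : (forall i, F i = k) -> \sum_i F i = m * k.
  by move=> Fk; rewrite (eq_bigr (fun=> k)) // sum_nat_const card_ord.
have exp0E n : 0 ^ n = (n == 0) by case: n => // n; rewrite exp0n.
rewrite hom_star big_star_vertex; congr (_ + (_ + _)).
- rewrite /indeg /outdeg !card_star_vertex /=.
  rewrite (@sum_const p _ 1) // (@sum_const q _ 0) //.
  rewrite (@sum_const p _ 0) // (@sum_const q _ 1) //.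
  by rewrite !muln0 !muln1 addn0.
- rewrite (@sum_const _ _ (a == 0)) 1?mulnC // => i.
  rewrite /indeg /outdeg !card_star_vertex /=.
  by rewrite !(@sum_const _ _ 0) // !muln0 exp1n muln1 exp0E.
- rewrite (@sum_const _ _ (b == 0)) 1?mulnC // => i.
  rewrite /indeg /outdeg !card_star_vertex /=.
  by rewrite !(@sum_const _ _ 0) // !muln0 exp1n mul1n exp0E.
Qed.

(** The source with [a] in-leaves wins already at the centre of the target, so
    the contributions of the target's leaves to it are dropped.  As
    [c < a <= h], the other source has an out-leaf, and hence the target's
    leaves contribute to its count only when [c = 0]. *)
Lemma unbalanced_star_ltn (h a c : nat) : 1 < h -> c < a -> a <= h ->
  hom (star c (h - c)) (star (2 ^ h).+1 2) <
  hom (star a (h - a)) (star (2 ^ h).+1 2).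
Proof.
move=> h_gt1 lt_ca le_ah; rewrite !hom_star_star.
set p := (2 ^ h).+1.
have p_gt2 : 2 < p by rewrite ltnS (leq_exp2l 1) // ltnW.
have a_gt0 : 0 < a by apply: leq_trans lt_ca.
have hc_gt0 : 0 < h - c by rewrite subn_gt0 (leq_trans lt_ca).
rewrite (gtn_eqF hc_gt0) mul0n addn0; apply: leq_trans (leq_addr _ _).
case: (posnP c) => [-> | c_gt0].
  rewrite expn0 subn0 !mul1n.
  (* The weakest case [a = 1] leaves [h - 1 >= 1] factors 2 besides [p]; for
     larger [a] some of these factors are replaced by [p]. *)
  have le_2p : p * 2 <= p ^ a * 2 ^ (h - a).
    rewrite -[X in p ^ X]prednK // expnS -mulnA leq_pmul2l //.
    have le_exp : 2 ^ a.-1 <= p ^ a.-1.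
      by case: a.-1 => // n; rewrite leq_exp2r // ltnW.
    apply: leq_trans (leq_mul le_exp (leqnn _)); rewrite -expnD.
    by rewrite (leq_exp2l 1) // -subn1 addnC addnBA // subnK // subn_gt0.
  by apply: leq_trans le_2p; rewrite muln2 -addnn ltn_add2r.
rewrite mul0n addn0.
have -> : h - c = (a - c) + (h - a) by rewrite addnC addnBA ?(ltnW lt_ca) // subnK.
have -> : p ^ a = p ^ c * p ^ (a - c) by rewrite -expnD subnKC // ltnW.
rewrite expnD mulnA.
rewrite ltn_pmul2r ?expn_gt0 // ltn_pmul2l ?expn_gt0 //.
by rewrite ltn_exp2r // subn_gt0.
Qed.

(** Reversing all arcs of both source and target preserves homomorphisms, and
    the reverse of [star a b] is [star b a]. *)
Lemma hom_star_star_rev (a b p q : nat) :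
  hom (star a b) (star p q) = hom (star b a) (star q p).
Proof. by rewrite !hom_star_star [p ^ a * _]mulnC [X in _ + X]addnC. Qed.

Lemma star_strictly_above (h a c : nat) : 1 < h -> a <= h -> c <= h -> a <> c ->
  exists H : digraph, hom (star c (h - c)) H < hom (star a (h - a)) H.
Proof.
move=> h_gt1 le_ah le_ch /eqP; rewrite neq_ltn => /orP[lt_ac | lt_ca].
  exists (star 2 (2 ^ h).+1); rewrite !(hom_star_star_rev _ _ 2).
  have := @unbalanced_star_ltn h (h - a) (h - c) h_gt1.
  by rewrite !subKn // leq_subr ltn_sub2l ?(leq_trans lt_ac) //; apply.
by exists (star (2 ^ h).+1 2); apply: unbalanced_star_ltn.
Qed.

Lemma digraph_iso_refl (D : digraph) : digraph_iso D D.
Proof. by exists id; split=> //; exists id. Qed.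

Theorem lemma3p2 (h : nat) (h_ge1 : 1 <= h) :
  (1 < h ->
   forall a c : nat, a <= h -> c <= h -> a <> c ->
     exists H H' : digraph,
       hom (star a (h - a)) H > hom (star c (h - c)) H /\
       hom (star a (h - a)) H' < hom (star c (h - c)) H')
  /\
  (forall a c : nat, a <= h -> c <= h ->
     hom_le (star a (h - a)) (star c (h - c)) ->
     digraph_iso (star a (h - a)) (star c (h - c))).
Proof.
split=> [h_gt1 a c le_ah le_ch neq_ac | a c le_ah le_ch le_hom].
  have [H H_gt] := star_strictly_above _ _ _ h_gt1 le_ah le_ch neq_ac.
  have [H' H'_lt] := star_strictly_above _ _ _ h_gt1 le_ch le_ah (nesym neq_ac).
  by exists H, H'.
have [-> | /eqP neq_ac] := eqVneq a c; first exact: digraph_iso_refl.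
have [h_le1 | h_gt1] := leqP h 1; last first.
  have [H] := star_strictly_above _ _ _ h_gt1 le_ah le_ch neq_ac.
  by rewrite ltnNge le_hom.
have h1 : h = 1 by apply/eqP; rewrite eqn_leq h_le1.
move: le_ah le_ch neq_ac {le_hom}; rewrite h1.
case: a c => [|[|//]] [|[|//]] // _ _ _.
- exact: star01_iso.
- exact: digraph_iso_sym star01_iso.
Qed.
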